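(* Let $(P,\omega,\mathcal J,\mathfrak s)$ be an almost Kähler manifold on which a Lie group $G$ acts freely and properly by automorphisms of the almost Kähler structure, with equivariant momentum map $J:P\to\mathfrak g^*$. Then the connection one-form $\mathcal A$ of the abstract mechanical connection on $P\to P/G$ can be written as $$\mathcal A(x)\cdot w=\mathbb I^{-1}(x)\cdot\operatorname{forg}\big(T_xJ(\mathcal Jw)\big)\qquad\text{for all }x\in P,\ w\in T_xP,$$ and consequently its horizontal spaces are $$\operatorname{hor}(x)=\operatorname{Ker}\big(T_xJ\circ\mathcal J\big).$$
   Context: Almost Kähler: $\omega$ is a symplectic form, $\mathcal J$ an almost complex structure ($\mathcal J^2=-1$), $\mathfrak s$ a $\mathcal J$-invariant Riemannian metric, related by $\omega(v,w)=\mathfrak s(\mathcal Jv,w)$. $G$ acts preserving $\omega$, $\mathcal J$ and $\mathfrak s$. $\xi_P$ is the infinitesimal generator of $\xi\in\mathfrak g$. The momentum map $J$ is $\operatorname{Ad}^*$-equivariant, with $\omega(\xi_P,\cdot)=d\langle J,\xi\rangle$. The quotient map $\pi:P\to P/G$ and $J:P\to U=J(P)\subset\mathfrak g^*$ are surjective submersions. $\operatorname{forg}:TU\to\mathfrak g^*$ is the map forgetting the base point (identifying tangent vectors to $U\subset\mathfrak g^*$ with elements of $\mathfrak g^*$). Abstract locked inertia tensor: $\mathbb I(x):\mathfrak g\to\mathfrak g^*$, $\langle\mathbb I(x)\xi,\eta\rangle=\mathfrak s(\xi_P(x),\eta_P(x))$ (an isomorphism since the action is free). Abstract mechanical connection: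 the principal connection on $P\to P/G$ with horizontal spaces $\operatorname{hor}(x)=\{v\in T_xP:\mathfrak s(v,\xi_P(x))=0\ \forall\,\xi\in\mathfrak g\}$. Its connection one-form is the $\mathfrak g$-valued one-form $\mathcal A$ with $\operatorname{Ker}\mathcal A(x)=\operatorname{hor}(x)$ and $\mathcal A(\xi_P(x))=\xi$ for all $\xi\in\mathfrak g$. *)

(* Defs.v *)
From HB Require Import structures.
From mathcomp Require Import all_boot all_order all_algebra.
From mathcomp Require Import all_classical all_reals all_analysis.

Set Implicit Arguments.
Unset Strict Implicit.
Unset Printing Implicit Defensive.
Import Order.TTheory GRing.Theory Num.Theory.
Import numFieldNormedType.Exports.
Local Open Scope classical_set_scope.
Local Open Scope ring_scope.

(* C^k on a set [A], meant for open [A]: differentiable at every point of [A],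
   with all directional derivatives C^(k-1) on [A].  In finite dimension this
   is the usual notion. *)
Fixpoint Ck_on (R : realType) (V W : normedModType R) (k : nat)
    (A : set V) (f : V -> W) : Prop :=
  if k is k'.+1 then
    (forall x, A x -> differentiable f x) /\
    (forall v, Ck_on k' A (fun x => 'd f x v))
  else forall x, A x -> {for x, continuous f}.

Definition smooth_on (R : realType) (V W : normedModType R)
    (A : set V) (f : V -> W) : Prop :=
  forall k, Ck_on k A f.

(* [cof] is the inverse of [cto] on [cto @` cdom]; both maps are total, their
   values elsewhere are irrelevant. *)
Record chart (M E : Type) := Chart {
  cdom : set M;
  cto : M -> E;
  cof : E -> M }.

Definition ccod (M E : Type) (c : chart M E) : set E := cto c @` cdom c.

Definition is_chart (R : realType) (M : topologicalType) (E : normedModType R)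
    (c : chart M E) : Prop :=
  [/\ open (cdom c), open (ccod c), {in cdom c, cancel (cto c) (cof c)},
      {within cdom c, continuous (cto c)} &
      {within ccod c, continuous (cof c)}].

(* An atlas is indexed by the points of [M]: [a x] is a chart around [x].
   Every atlas contains one of this form, defining the same smooth
   structure. *)
Definition atlas (M E : Type) := M -> chart M E.

Definition self_atlas (E : Type) : atlas E E := fun=> Chart setT id id.
Arguments self_atlas : clear implicits.

Definition prod_atlas (M N E F : Type) (a : atlas M E) (b : atlas N F) :
    atlas (M * N) (E * F) :=
  fun p => Chart (cdom (a p.1) `*` cdom (b p.2))
                 (fun q => (cto (a p.1) q.1, cto (b p.2) q.2))
                 (fun q => (cof (a p.1) q.1, cof (b p.2) q.2)).

Definition smooth_map (R : realType) (M N : topologicalType)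
    (E F : normedModType R) (a : atlas M E) (b : atlas N F) (f : M -> N) :
    Prop :=
  continuous f /\
  forall x y, smooth_on (cto (a x) @` (cdom (a x) `&` f @^-1` cdom (b y)))
                        (cto (b y) \o f \o cof (a x)).

(* A tangent vector at [x] is represented by its coordinates in the chart
   [a x]. *)
Definition tangent (R : realType) (M : Type) (E : normedModType R)
    (a : atlas M E) (x : M) : normedModType R := E.

Definition tmap (R : realType) (M N : Type) (E F : normedModType R)
    (a : atlas M E) (b : atlas N F) (f : M -> N) (x : M) :
    tangent a x -> tangent b (f x) :=
  'd (cto (b (f x)) \o f \o cof (a x)) (cto (a x) x).
Arguments tmap {R M N E F} a b f x v.

(* The vector at the point of coordinates [u] in the chart [a y] whose
   coordinates in that chart are [e]. *)
Definition frame (R : realType) (M : Type) (E : normedModType R)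
    (a : atlas M E) (y : M) (u : E) (e : E) : tangent a (cof (a y) u) :=
  tmap (self_atlas E) a (cof (a y)) u e.

Record manifold (R : realType) (n : nat) (M : topologicalType) := Manifold {
  chart_at :> atlas M 'rV[R]_n;
  _ : hausdorff_space M;
  _ : @second_countable M;
  _ : forall x, is_chart (chart_at x);
  _ : forall x, cdom (chart_at x) x;
  _ : forall x y,
      smooth_on (cto (chart_at x) @` (cdom (chart_at x) `&` cdom (chart_at y)))
                (cto (chart_at y) \o cof (chart_at x)) }.

HB.structure Definition GroupTopological := {G of Group G & Topological G}.

Record lie_group (R : realType) (m : nat) (G : GroupTopological.type) :=
  LieGroup {
  lie_manifold :> manifold R m G;
  _ : smooth_map (prod_atlas lie_manifold lie_manifold) lie_manifold
        (fun gh : G * G => (gh.1 * gh.2)%g);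
  _ : smooth_map lie_manifold lie_manifold (fun g : G => g^-1%g) }.

(* The dual of ['rV[R]_m], a column [mu] being the linear form with matrix
   [mu]. *)
Definition dual (R : realType) (m : nat) : normedModType R := 'cV[R]_m.

Definition pairing (R : realType) (m : nat) (mu : dual R m) (xi : 'rV[R]_m) :
    R := (xi *m (mu : 'cV[R]_m)) 0 0.

Definition dual_atlas (R : realType) (m : nat) :
  atlas (dual R m) (dual R m) := self_atlas (dual R m).

Definition forg (R : realType) (m : nat) (mu : dual R m)
    (v : tangent (@dual_atlas R m) mu) : dual R m := v.
Arguments forg {R m} mu v.

Definition smooth_form1 (R : realType) (n : nat) (T : topologicalType)
    (P : manifold R n T) (W : normedModType R)
    (A : forall x, tangent P x -> W) : Prop :=
  forall y e, smooth_on (ccod (chart_at P y))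
                (fun u => A (cof (chart_at P y) u) (frame P y u e)).

Definition local_form2 (R : realType) (n : nat) (T : topologicalType)
    (P : manifold R n T) (B : forall x, tangent P x -> tangent P x -> R)
    (y : T) (e f : 'rV[R]_n) : 'rV[R]_n -> R :=
  fun u => B (cof (chart_at P y) u) (frame P y u e) (frame P y u f).

Definition smooth_form2 (R : realType) (n : nat) (T : topologicalType)
    (P : manifold R n T) (B : forall x, tangent P x -> tangent P x -> R) :
    Prop :=
  forall y e f, smooth_on (ccod (chart_at P y)) (local_form2 B y e f : _ -> R^o).

(* For alternating [B], the left-hand side is [dB (e, f, g)] computed on the
   constant vector fields of the chart at [y]. *)
Definition closed_form2 (R : realType) (n : nat) (T : topologicalType)
    (P : manifold R n T) (B : forall x, tangent P x -> tangent P x -> R) :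
    Prop :=
  forall y e f g u, ccod (chart_at P y) u ->
    'D_e (local_form2 B y f g : _ -> R^o) u +
    'D_f (local_form2 B y g e : _ -> R^o) u +
    'D_g (local_form2 B y e f : _ -> R^o) u = 0.

Definition smooth_endo (R : realType) (n : nat) (T : topologicalType)
    (P : manifold R n T) (C : forall x, tangent P x -> tangent P x) : Prop :=
  forall y e, smooth_on (ccod (chart_at P y))
    (fun u => tmap P (self_atlas 'rV[R]_n) (cto (chart_at P y)) (cof (chart_at P y) u)
                (C (cof (chart_at P y) u) (frame P y u e)) : 'rV[R]_n).

Record almost_kaehler (R : realType) (n : nat) (T : topologicalType)
    (P : manifold R n T) := AlmostKaehler {
  omega : forall x, {biscalar tangent P x};
  cplx : forall x, {linear tangent P x -> tangent P x};
  metric : forall x, {biscalar tangent P x};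
  _ : smooth_form2 (fun x => omega x);
  _ : forall x v, omega x v v = 0;
  _ : forall x v, (forall w, omega x v w = 0) -> v = 0;
  _ : closed_form2 (fun x => omega x);
  _ : smooth_endo (fun x => cplx x);
  _ : forall x v, cplx x (cplx x v) = - v;
  _ : smooth_form2 (fun x => metric x);
  _ : forall x v w, metric x v w = metric x w v;
  _ : forall x v, v != 0 -> 0 < metric x v v;
  _ : forall x v w, metric x (cplx x v) (cplx x w) = metric x v w;
  _ : forall x v w, omega x v w = metric x (cplx x v) w }.

Definition proper_map (S T : topologicalType) (f : S -> T) : Prop :=
  forall K : set T, compact K -> compact (f @^-1` K).

Record ak_action (R : realType) (m n : nat) (G : GroupTopological.type)
    (T : topologicalType) (LG : lie_group R m G) (P : manifold R n T)
    (K : almost_kaehler P) (act : G -> T -> T) : Prop := AkAction {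
  _ : smooth_map (prod_atlas LG P) P (fun gx : G * T => act gx.1 gx.2);
  _ : forall x, act 1%g x = x;
  _ : forall g h x, act (g * h)%g x = act g (act h x);
  _ : forall g x v w, omega K (act g x) (tmap P P (act g) x v)
                                        (tmap P P (act g) x w) = omega K x v w;
  _ : forall g x v, cplx K (act g x) (tmap P P (act g) x v) =
                    tmap P P (act g) x (cplx K x v);
  _ : forall g x v w, metric K (act g x) (tmap P P (act g) x v)
                               (tmap P P (act g) x w) = metric K x v w }.

Definition free_action (G : groupType) (T : Type) (act : G -> T -> T) : Prop :=
  forall g x, act g x = x -> g = 1%g.

Definition proper_action (G : GroupTopological.type) (T : topologicalType)
    (act : G -> T -> T) : Prop :=
  proper_map (fun gx : G * T => (act gx.1 gx.2, gx.2)).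

(* The Lie algebra of [G] is its tangent space at 1, which is ['rV[R]_m]. *)
Definition Ad (R : realType) (m : nat) (G : GroupTopological.type)
    (LG : lie_group R m G) (g : G) (xi : 'rV[R]_m) : 'rV[R]_m :=
  tmap LG LG (fun h : G => (g * h * g^-1)%g) 1%g xi.

(* [xi_P x]; it lies in the tangent space at [act 1 x = x]. *)
Definition generator (R : realType) (m n : nat) (G : GroupTopological.type)
    (T : topologicalType) (LG : lie_group R m G) (P : manifold R n T)
    (act : G -> T -> T) (xi : 'rV[R]_m) (x : T) : tangent P x :=
  tmap LG P (act^~ x) 1%g xi.

Record momentum_map (R : realType) (m n : nat) (G : GroupTopological.type)
    (T : topologicalType) (LG : lie_group R m G) (P : manifold R n T)
    (K : almost_kaehler P) (act : G -> T -> T) (J : T -> dual R m) : Prop :=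
  MomentumMap {
  _ : smooth_map P (@dual_atlas R m) J;
  _ : forall (xi : 'rV[R]_m) x v,
      omega K x (generator LG P act xi x) v =
      tmap P (self_atlas R^o) (fun y => pairing (J y) xi : R^o) x v;
  _ : forall g x xi, pairing (J (act g x)) xi =
                     pairing (J x) (Ad LG g^-1%g xi) }.

Definition inertia (R : realType) (m n : nat) (G : GroupTopological.type)
    (T : topologicalType) (LG : lie_group R m G) (P : manifold R n T)
    (K : almost_kaehler P) (act : G -> T -> T) (x : T) (xi : 'rV[R]_m) :
    'cV[R]_m :=
  \col_j metric K x (generator LG P act xi x)
                    (generator LG P act (delta_mx 0 j) x).

(* [^-1%VF] is the inverse as soon as [inertia] is bijective. *)
Definition inertia_inv (R : realType) (m n : nat) (G : GroupTopological.type)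
    (T : topologicalType) (LG : lie_group R m G) (P : manifold R n T)
    (K : almost_kaehler P) (act : G -> T -> T) (x : T) (mu : dual R m) :
    'rV[R]_m :=
  ((linfun (inertia LG K act x))^-1)%VF mu.

Lemma pairing_inertia (R : realType) (m n : nat) (G : GroupTopological.type)
    (T : topologicalType) (LG : lie_group R m G) (P : manifold R n T)
    (K : almost_kaehler P) (act : G -> T -> T) (x : T) (xi eta : 'rV[R]_m) :
  pairing (inertia LG K act x xi : dual R m) eta =
  metric K x (generator LG P act xi x) (generator LG P act eta x).
Proof.
rewrite /pairing mxE {2}(row_sum_delta eta) /generator /tmap !linear_sum.
by apply: eq_bigr => j _; rewrite !linearZ mxE.
Qed.

Definition hor (R : realType) (m n : nat) (G : GroupTopological.type)
    (T : topologicalType) (LG : lie_group R m G) (P : manifold R n T)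
    (K : almost_kaehler P) (act : G -> T -> T) (x : T) : set (tangent P x) :=
  [set v | forall xi, metric K x v (generator LG P act xi x) = 0].
Arguments hor {R m n G T} LG {P} K act x.

Record mech_connection_form (R : realType) (m n : nat)
    (G : GroupTopological.type) (T : topologicalType) (LG : lie_group R m G)
    (P : manifold R n T) (K : almost_kaehler P) (act : G -> T -> T)
    (A : forall x, {linear tangent P x -> 'rV[R]_m}) : Prop :=
  MechConnectionForm {
  _ : smooth_form1 (fun x => A x);
  _ : forall x, [set w | A x w = 0] = hor LG K act x;
  _ : forall x xi, A x (generator LG P act xi x) = xi }.

(* Main.v *)
From HB Require Import structures.
Require Import Defs.
From mathcomp Require Import all_boot all_order all_algebra.
From mathcomp Require Import all_classical all_reals all_analysis.
Import Order.TTheory GRing.Theory Num.Theory.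
Import numFieldNormedType.Exports.
Local Open Scope classical_set_scope.
Local Open Scope ring_scope.

(** Everything follows from one identity: for all [w] at [x] and all [xi],
      < T_x J (Jw), xi > = omega (xi_P, Jw) = s (J xi_P, Jw) = s (w, xi_P),
    where the [J] applied to vectors is the complex structure.  The first
    equality is the momentum map condition, the second the compatibility of
    [omega] with [s], and the third the invariance and symmetry of [s]; this is
    [pairing_momentum_cplx].  As elements of the dual are separated by their
    pairings, T_x J (Jw) = 0 means exactly that [w] is orthogonal to all
    [xi_P x], i.e., that [w] is horizontal.

    For the connection form [A], put xi = A w.  Then w - xi_P has A-value 0, so
    it is horizontal, and
      < I xi, eta > = s (xi_P, eta_P) = s (w, eta_P) = < T_x J (Jw), eta >
    for all [eta], that is, I xi = T_x J (Jw).  It remains to invert the inertia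
    tensor [I].  Since A xi_P = xi, the map xi |-> xi_P is injective; [I] is its
    Gram operator for a positive definite form, hence injective
    ([inertia_inj]), and bijective because the Lie algebra and its dual have
    the same dimension ([inertia_bij]). *)

Set Implicit Arguments.
Unset Strict Implicit.
Unset Printing Implicit Defensive.

(** The pairing as a function of its first argument, with values in the normed
    module [R^o], so that it can carry a linear structure and be
    differentiated. *)
Definition eval_at (R : realType) (m : nat) (xi : 'rV[R]_m) (mu : dual R m) :
  R^o := pairing mu xi.

Lemma eval_at_is_linear (R : realType) (m : nat) (xi : 'rV[R]_m) :
  linear (eval_at xi).
Proof. by move=> a mu nu; rewrite /eval_at /pairing mulmxDr -scalemxAr !mxE. Qed.

HB.instance Definition _ (R : realType) (m : nat) (xi : 'rV[R]_m) :=
  GRing.isLinear.Build R (dual R m) R^o _ (eval_at xi) (eval_at_is_linear xi).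

Lemma eval_at_continuous (R : realType) (m : nat) (xi : 'rV[R]_m) :
  continuous (eval_at xi).
Proof.
rewrite (_ : eval_at xi = fun mu : dual R m =>
  \sum_j xi 0 j * (mu : 'cV[R]_m) j 0); last first.
  by apply/funext => mu; rewrite /eval_at /pairing mxE.
apply: continuous_big => [|j _ mu]; first exact: add_continuous.
by apply: continuousM; [exact: cst_continuous | exact: coord_continuous].
Qed.

Lemma pairing_inj (R : realType) (m : nat) (mu nu : dual R m) :
  (forall xi, pairing mu xi = pairing nu xi) -> mu = nu.
Proof.
move=> mu_nu; apply/matrixP => j k; rewrite (ord1 k).
by have := mu_nu (delta_mx 0 j); rewrite /pairing -!rowE !mxE.
Qed.

Section Momentum.
Variables (R : realType) (m n : nat) (G : GroupTopological.type).
Variables (T : topologicalType) (LG : lie_group R m G) (P : manifold R n T).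
Variables (K : almost_kaehler P) (act : G -> T -> T).

Lemma manifold_base (x : T) : cdom (chart_at P x) x.
Proof. by case: P. Qed.

(** The chain rule: pairing with a fixed [xi] is a continuous linear map, hence
    its own differential. *)
Lemma pairing_tmap (J : T -> dual R m) (xi : 'rV[R]_m) (x : T)
    (v : tangent P x) :
  smooth_map P (@dual_atlas R m) J ->
  pairing (forg (J x) (tmap P (@dual_atlas R m) J x v)) xi =
  tmap P (self_atlas R^o) (fun y => pairing (J y) xi : R^o) x v.
Proof.
move=> [_ /(_ x (J x) 1%N)[dJ _]].
have {}dJ : differentiable (J \o cof (chart_at P x)) (cto (chart_at P x) x).
  (* The chart of the dual is global, so smoothness of [J] says that its
     expression in the chart at [x] is differentiable on the whole codomain of
     that chart. *)
  by apply: dJ; exists x => //; split => //; exact: manifold_base.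
rewrite /tmap /forg /=.
rewrite [in RHS](_ : _ \o _ = eval_at xi \o (J \o cof (chart_at P x))) //.
rewrite diff_comp //; last first.
  by apply: linear_differentiable; exact: eval_at_continuous.
by rewrite /= diff_lin //; exact: eval_at_continuous.
Qed.

(** The identity behind both conclusions: composing the differential of the
    momentum map with the complex structure turns [omega] back into the
    metric. *)
Lemma pairing_momentum_cplx (J : T -> dual R m) (xi : 'rV[R]_m) (x : T)
    (w : tangent P x) :
  momentum_map LG K act J ->
  pairing (forg (J x) (tmap P (@dual_atlas R m) J x (cplx K x w))) xi =
  metric K x w (generator LG P act xi x).
Proof.
move=> [Jsm Jom _]; rewrite pairing_tmap // -Jom.
case: (K) => om cx s /= _ _ _ _ _ _ _ sC _ sJ omE.
by rewrite omE sJ sC.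
Qed.

Lemma metric_eq0 (x : T) (v : tangent P x) : metric K x v v = 0 -> v = 0.
Proof.
case: (K) => om cx s /= _ _ _ _ _ _ _ _ s_gt0 _ _ svv.
by apply/eqP/contraT => /s_gt0; rewrite svv ltxx.
Qed.

Lemma inertia_is_linear (x : T) : linear (inertia LG K act x).
Proof.
move=> a xi eta; apply/matrixP => i j; rewrite !mxE /generator /tmap.
by rewrite linearP linearPl.
Qed.

HB.instance Definition _ (x : T) :=
  GRing.isLinear.Build R 'rV[R]_m 'cV[R]_m _ (inertia LG K act x)
    (inertia_is_linear x).

(** If [inertia x xi = 0], then pairing with [xi] itself gives
    [s (xi_P x) (xi_P x) = 0], so [xi_P x = 0] by positivity of the metric. *)
Lemma inertia_inj (x : T) :
  injective (fun xi => generator LG P act xi x) -> injective (inertia LG K act x).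
Proof.
move=> genI; apply: raddf_inj => xi xi0; apply: genI.
rewrite [RHS](linear0 ('d _ _)); apply: metric_eq0.
by rewrite -(pairing_inertia LG K act) xi0 /pairing mulmx0 mxE.
Qed.

(** [inertia_inv] is defined by the inverse of the associated ['Hom], which is a
    left inverse as soon as the kernel is trivial. *)
Lemma inertiaK (x : T) : injective (inertia LG K act x) ->
  cancel (inertia LG K act x) (inertia_inv LG K act x).
Proof.
move=> inertiaI xi; rewrite /inertia_inv -[inertia _ _ _ _ xi]lfunE.
apply: lker0_lfunK; apply/lker0P => xi1 xi2.
by rewrite !lfunE; exact: inertiaI.
Qed.

(** An injective linear map between spaces of equal dimension is onto. *)
Lemma inertia_bij (x : T) : injective (inertia LG K act x) ->
  bijective (inertia LG K act x).
Proof.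
move=> inertiaI; exists (inertia_inv LG K act x); first exact: inertiaK.
move=> mu; rewrite /inertia_inv -[LHS]lfunE; apply: limg_lfunVK.
have ker0 : lker (linfun (inertia LG K act x)) == 0%VS.
  by apply/lker0P => xi1 xi2; rewrite !lfunE; exact: inertiaI.
suff -> : limg (linfun (inertia LG K act x)) = fullv by exact: memvf.
apply/eqP; rewrite eqEdim subvf limg_dim_eq; last by rewrite (eqP ker0) capv0.
by rewrite !dimvf !dim_matrix mulr1 mul1r leqnn.
Qed.

End Momentum.

Theorem corollary4p5 (R : realType) (m n : nat) (G : GroupTopological.type)
    (T : topologicalType) (LG : lie_group R m G) (P : manifold R n T)
    (K : almost_kaehler P) (act : G -> T -> T) (J : T -> dual R m)
    (act_ak : ak_action LG K act) (act_free : free_action act)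
    (act_proper : proper_action act) (J_mom : momentum_map LG K act J) :
  (forall A : forall x, {linear tangent P x -> 'rV[R]_m},
     mech_connection_form LG K act A ->
     forall x, bijective (inertia LG K act x) /\
       forall w : tangent P x,
         A x w = inertia_inv LG K act x
                   (forg (J x) (tmap P (@dual_atlas R m) J x (cplx K x w)))) /\
  (forall x, hor LG K act x =
     [set w | tmap P (@dual_atlas R m) J x (cplx K x w) = 0]).
Proof.
split=> [A [_ kerA Agen] x | x].
  have inertiaI : injective (inertia LG K act x).
    by apply: inertia_inj => xi eta /(congr1 (A x)); rewrite !Agen.
  split=> [|w]; first exact: inertia_bij.
  rewrite -[LHS](inertiaK inertiaI); congr inertia_inv.
  apply: pairing_inj => eta.
  rewrite pairing_inertia (pairing_momentum_cplx eta w J_mom).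
  apply/eqP; rewrite -subr_eq0 -linearBl; apply/eqP.
  (* The [A]-value of [v] is [A w - A w], so [v] is horizontal. *)
  set v := _ - _.
  have : hor LG K act x v by rewrite -kerA /= linearB /= Agen subrr.
  exact.
apply/seteqP; split=> w /= hw.
  apply: pairing_inj => xi; rewrite [LHS](pairing_momentum_cplx xi w J_mom) hw.
  by rewrite /pairing mulmx0 mxE.
move=> xi; rewrite -(pairing_momentum_cplx xi w J_mom) hw.
by rewrite /pairing /forg mulmx0 mxE.
Qed.
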